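(* Let $p$ be a prime number. Then the restricted wreath product $C_p\wr\mathbb{Z}^2$ is a self-similar group of degree $p+1$ and orbit-type $(p,1)$. Indeed, $C_p\wr\mathbb{Z}^2$ is isomorphic to the subgroup of $\mathcal{A}_{p+1}$ generated by the automorphisms $\alpha,\sigma,\beta$ of the $(p+1)$-tree on the alphabet $\{0,1,\dots,p\}$ defined recursively by $$\alpha=(\alpha,\alpha\sigma,\dots,\alpha\sigma^{p-1},\alpha\beta),\qquad \sigma=(e,\dots,e,\sigma)(0\,1\,\dots\,p-1),\qquad \beta=(e,\dots,e,\alpha),$$ which is state-closed. In particular, the group $C_2\wr\mathbb{Z}^2$ is self-similar of degree $3$.
   Context: $C_p$ is the cyclic group of order $p$; $A\wr U=\big(\bigoplus_{u\in U}A\big)\rtimes U$ is the restricted wreath product. For $m\ge1$, $\mathcal{A}_m$ is the automorphism group of the rooted $m$-tree of finite strings over $Y=\{0,\dots,m-1\}$, acting on the right, with products composed from left to right and identity $e$. Each $\gamma\in\mathcal{A}_m$ is written $\gamma=(\gamma_0,\dots,\gamma_{m-1})\tau$ with $\tau\in\mathrm{Sym}(Y)$ its action on the first level and states $\gamma_y\in\mathcal{A}_m$ given by $(yu)^\gamma=y^{\tau}u^{\gamma_y}$ ($\tau$ is omitted when trivial). In the claim each tuple has $p+1$ entries, indexed by $0,\dots,p$: the state of $\alpha$ at letter $i$ is $\alpha\sigma^i$ for $0\le i\le p-1$ and $\alpha\beta$ at letter $p$; $\sigma$ has trivial states at $0,\dots,p-1$, state $\sigma$ at $p$, and acts on the first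 level by the $p$-cycle $(0\,1\,\dots\,p-1)$ fixing $p$; $\beta$ has trivial states at $0,\dots,p-1$ and state $\alpha$ at $p$. A subgroup of $\mathcal{A}_m$ is state-closed if it contains all states of its elements. A group is self-similar of degree $m$ if it is isomorphic to a state-closed subgroup of $\mathcal{A}_m$, and it is so with orbit-type $(m_1,\dots,m_s)$ if that subgroup has exactly $s$ orbits on $Y$, of sizes $m_1,\dots,m_s$ (transitivity is not required). *)

(* Defs.v *)
From HB Require Import structures.
From mathcomp Require Import all_boot all_fingroup all_algebra.
From mathcomp Require Import finmap.
From mathcomp Require Import boolp classical_sets.

Set Implicit Arguments.
Unset Strict Implicit.
Unset Printing Implicit Defensive.

Local Open Scope group_scope.

(* The rooted m-tree is [seq 'I_m]: the root is [::], and [u] is an ancestor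
   of [v] iff [prefix u v].  Its automorphisms are the automorphisms of this
   order; they fix the root and preserve levels (size_aut below). *)
Record tree_aut (m : nat) := TreeAut {
  aut_fun :> seq 'I_m -> seq 'I_m;
  aut_bij : bijective aut_fun;
  aut_prefix : {mono aut_fun : u v / prefix u v}
}.

Section TreeAutGroup.
Variable m : nat.
Implicit Types (f g h : tree_aut m) (u v : seq 'I_m) (y : 'I_m).

HB.instance Definition _ := gen_eqMixin (tree_aut m).
HB.instance Definition _ := gen_choiceMixin (tree_aut m).

Lemma tree_autP f g : f =1 g -> f = g.
Proof.
case: f g => [f fb fp] [g gb gp] /= /funext eq_fg; subst g.
by rewrite (Prop_irrelevance fb gb) (Prop_irrelevance fp gp).
Qed.

Lemma aut_inj f : injective f. Proof. exact/bij_inj/aut_bij. Qed.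

Definition aut_one : tree_aut m :=
  @TreeAut m id (Bijective (frefl _) (frefl _)) (fun _ _ => erefl).

Lemma aut_mul_prefix f g : {mono g \o f : u v / prefix u v}.
Proof. by move=> u v /=; rewrite !aut_prefix. Qed.

(* Left-to-right: u^(f * g) = (u^f)^g. *)
Definition aut_mul f g : tree_aut m :=
  TreeAut (bij_comp (aut_bij g) (aut_bij f)) (@aut_mul_prefix f g).

Lemma aut_surj f v : exists u, f u == v.
Proof. by case: (aut_bij f) => g _ gK; exists (g v); rewrite gK. Qed.

Definition aut_inv_fun f v := xchoose (aut_surj f v).

Lemma aut_inv_funK f : cancel (aut_inv_fun f) f.
Proof. by move=> v; apply/eqP/(xchooseP (aut_surj f v)). Qed.

Lemma aut_funK f : cancel f (aut_inv_fun f).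
Proof. by move=> u; apply: (@aut_inj f); rewrite aut_inv_funK. Qed.

Lemma aut_inv_prefix f : {mono aut_inv_fun f : u v / prefix u v}.
Proof. by move=> u v; rewrite -[LHS](aut_prefix f) !aut_inv_funK. Qed.

Definition aut_inv f : tree_aut m :=
  TreeAut (Bijective (aut_inv_funK f) (aut_funK f)) (@aut_inv_prefix f).

Lemma aut_mulA : associative aut_mul.
Proof. by move=> f g h; apply: tree_autP. Qed.
Lemma aut_mul1 : left_id aut_one aut_mul.
Proof. by move=> f; apply: tree_autP. Qed.
Lemma aut_mul_1 : right_id aut_one aut_mul.
Proof. by move=> f; apply: tree_autP. Qed.
Lemma aut_mulV : left_inverse aut_one aut_inv aut_mul.
Proof. by move=> f; apply: tree_autP => u /=; rewrite aut_inv_funK. Qed.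
Lemma aut_mul_V : right_inverse aut_one aut_inv aut_mul.
Proof. by move=> f; apply: tree_autP => u /=; rewrite aut_funK. Qed.

HB.instance Definition _ := isGroup.Build (tree_aut m)
  aut_mulA aut_mul1 aut_mul_1 aut_mulV aut_mul_V.

Lemma aut1E u : (1 : tree_aut m) u = u. Proof. by []. Qed.
Lemma autME f g u : (f * g) u = g (f u). Proof. by []. Qed.
Lemma autVK f : cancel f f^-1. Proof. exact: aut_funK. Qed.
Lemma autKV f : cancel f^-1 f. Proof. exact: aut_inv_funK. Qed.

Lemma size_aut f u : size (f u) = size u.
Proof.
suff le_size (g : tree_aut m) w : size w <= size (g w).
  by apply/eqP; rewrite eqn_leq le_size -{2}(autVK f u) le_size.
elim/last_ind: w => // w y IHw; rewrite size_rcons (leq_ltn_trans IHw) //.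
have /prefixP[t gwy] : prefix (g w) (g (rcons w y)).
  by rewrite aut_prefix prefix_rcons.
rewrite gwy size_cat; case: t => [|z t] in gwy *; last by rewrite addnS ltnS leq_addr.
by move: gwy; rewrite cats0 => /aut_inj/(congr1 size)/eqP; rewrite size_rcons gtn_eqF.
Qed.

Definition level1_fun f y := head y (f [:: y]).

Lemma level1_funE f y : f [:: y] = [:: level1_fun f y].
Proof. by rewrite /level1_fun; case: (f _) (size_aut f [:: y]) => [|z [|]]. Qed.

Lemma level1_inj f : injective (level1_fun f).
Proof.
move=> y z eq_yz; suff [] : [:: y] = [:: z] by [].
by apply: (@aut_inj f); rewrite !level1_funE eq_yz.
Qed.

Definition level1 f : {perm 'I_m} := perm (@level1_inj f).

Definition state_fun f y u := behead (f (y :: u)).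

Lemma aut_consE f y u : f (y :: u) = level1 f y :: state_fun f y u.
Proof.
rewrite permE /state_fun.
have: prefix (f [:: y]) (f (y :: u)) by rewrite aut_prefix prefix_cons eqxx prefix0s.
by rewrite level1_funE; case: (f (y :: u)) => // z s; rewrite prefix_cons => /andP[/eqP-> _].
Qed.

Lemma state_funK f y : cancel (state_fun f y) (state_fun f^-1 (level1 f y)).
Proof. by move=> u; rewrite {1}/state_fun -aut_consE autVK. Qed.

Lemma level1K f y : level1 f^-1 (level1 f y) = y.
Proof. by have := autVK f [:: y]; rewrite !aut_consE; case. Qed.

Lemma state_fun_bij f y : bijective (state_fun f y).
Proof.
exists (state_fun f^-1 (level1 f y)); first exact: state_funK.
move=> v; rewrite {1}/state_fun.
by rewrite -{1}(level1K f y) -aut_consE autKV.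
Qed.

Lemma state_fun_prefix f y : {mono state_fun f y : u v / prefix u v}.
Proof.
move=> u v; have := aut_prefix f (y :: u) (y :: v).
by rewrite !aut_consE !prefix_cons !eqxx.
Qed.

Definition state f y : tree_aut m :=
  TreeAut (@state_fun_bij f y) (@state_fun_prefix f y).

Lemma autE f y u : f (y :: u) = level1 f y :: state f y u.
Proof. exact: aut_consE. Qed.

Section Decomposition.
Variables (c : 'I_m -> tree_aut m) (t : {perm 'I_m}).

Definition decomp_fun u := if u is y :: v then t y :: c y v else [::].
Let decomp_inv u :=
  if u is y :: v then t^-1 y :: (c (t^-1 y))^-1 v else [::].

Lemma decomp_fun_bij : bijective decomp_fun.
Proof.
exists decomp_inv; case=> // y u /=; first by rewrite permK aut_funK.
by rewrite permKV aut_inv_funK.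
Qed.

Lemma decomp_fun_prefix : {mono decomp_fun : u v / prefix u v}.
Proof.
case=> [|y u] [|z v] //=; rewrite ?prefix0s // (inj_eq perm_inj).
by case: eqP => [->|//]; rewrite aut_prefix.
Qed.

(* The automorphism (c 0, ..., c (m-1)) t. *)
Definition decomp : tree_aut m := TreeAut decomp_fun_bij decomp_fun_prefix.

Lemma level1_decomp : level1 decomp = t.
Proof. by apply/permP => y; rewrite permE. Qed.

Lemma state_decomp : state decomp =1 c.
Proof. by move=> y; apply: tree_autP. Qed.

End Decomposition.

Lemma decompK f : decomp (state f) (level1 f) = f.
Proof.
apply: tree_autP; case=> [|y u]; last by rewrite [RHS]autE.
by apply/esym/nilP; rewrite /nilp size_aut.
Qed.

End TreeAutGroup.

Local Open Scope classical_set_scope.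

Definition is_subgroup (G : groupType) (H : set G) : Prop :=
  [/\ H 1, forall x y, H x -> H y -> H (x * y) & forall x, H x -> H x^-1].

Definition generated_subgroup (G : groupType) (X : set G) : set G :=
  smallest (@is_subgroup G) X.

Definition isomorphic_to (G K : groupType) (H : set K) : Prop :=
  exists f : {multiplicative G -> K}, injective f /\ range f = H.

Definition state_closed (m : nat) (H : set (tree_aut m)) : Prop :=
  forall f y, H f -> H (state f y).

Definition level1_orbit (m : nat) (H : set (tree_aut m)) (y : 'I_m) :
  {set 'I_m} := finset (fun z => `[< exists2 f, H f & level1 f y = z >]).

Definition level1_orbits (m : nat) (H : set (tree_aut m)) : {set {set 'I_m}} :=
  [set level1_orbit H y | y : 'I_m]%SET.

Definition has_orbit_type (m : nat) (H : set (tree_aut m)) (t : seq nat) : Prop :=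
  perm_eq [seq #|B| | B : {set 'I_m} <- enum (level1_orbits H)] t.

Definition self_similar (G : groupType) (m : nat) : Prop :=
  exists H : set (tree_aut m),
    [/\ is_subgroup H, state_closed H & isomorphic_to G H].

Definition self_similar_of_type (G : groupType) (m : nat) (t : seq nat) : Prop :=
  exists H : set (tree_aut m),
    [/\ is_subgroup H, state_closed H, has_orbit_type H t & isomorphic_to G H].

(* Restricted wreath product A wr U.  The pair (b, u) stands for b * u, with
   u in U acting on the base group by right translation of the coordinates,
   (b ^ u) (w * u) = b w; hence (b, u) (c, v) = (b * (c ^ u^-1), u * v) where
   (c ^ u^-1) w = c (w * u). *)
Record wreath (A U : groupType) := Wreath {
  wbase : {fsfun U -> A with 1};
  wtop : U
}.

Section WreathGroup.
Variables A U : groupType.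
Implicit Types x y z : wreath A U.

Definition wreath_pair x := (wbase x, wtop x).
Definition pair_wreath (bu : {fsfun U -> A with 1} * U) := Wreath bu.1 bu.2.

Lemma wreath_pairK : cancel wreath_pair pair_wreath. Proof. by case. Qed.

HB.instance Definition _ := Choice.copy (wreath A U) (can_type wreath_pairK).

Lemma wreathP x y : wbase x =1 wbase y -> wtop x = wtop y -> x = y.
Proof. by case: x y => [b u] [c v] /= /fsfunP -> ->. Qed.

Definition wreath_one : wreath A U := Wreath [fsfun] 1.

Definition wreath_mul x y : wreath A U :=
  Wreath [fsfun w in (finsupp (wbase x) `|`
                      [fset (v * (wtop x)^-1)%g | v in finsupp (wbase y)])%fset
            => wbase x w * wbase y (w * wtop x) | 1]
         (wtop x * wtop y).

Definition wreath_inv x : wreath A U :=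
  Wreath [fsfun w in [fset (v * wtop x)%g | v in finsupp (wbase x)]%fset
            => (wbase x (w * (wtop x)^-1))^-1 | 1]
         (wtop x)^-1.

Lemma wbase1E w : wbase wreath_one w = 1.
Proof. by rewrite fsfunE. Qed.

Lemma wbaseME x y w :
  wbase (wreath_mul x y) w = wbase x w * wbase y (w * wtop x).
Proof.
rewrite fsfunE in_fsetU; case: ifPn => //; rewrite negb_or => /andP[xw].
move=> /imfsetP yw; rewrite fsfun_dflt // mul1g fsfun_dflt //.
by apply/negP => wy; apply: yw; exists (w * wtop x) => //; rewrite mulgK.
Qed.

Lemma wbaseVE x w : wbase (wreath_inv x) w = (wbase x (w * (wtop x)^-1))^-1.
Proof.
rewrite fsfunE; case: ifPn => // /imfsetP xw; rewrite fsfun_dflt ?invg1 //.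
by apply/negP => wx; apply: xw; exists (w * (wtop x)^-1) => //; rewrite mulgVK.
Qed.

Lemma wreath_mulA : associative wreath_mul.
Proof.
move=> x y z; apply: wreathP => [w|]; last by rewrite /= mulgA.
by rewrite !wbaseME /= !mulgA.
Qed.

Lemma wreath_mul1 : left_id wreath_one wreath_mul.
Proof.
move=> x; apply: wreathP => [w|]; last by rewrite /= mul1g.
by rewrite wbaseME wbase1E mul1g mulg1.
Qed.

Lemma wreath_mul_1 : right_id wreath_one wreath_mul.
Proof.
move=> x; apply: wreathP => [w|]; last by rewrite /= mulg1.
by rewrite wbaseME wbase1E mulg1.
Qed.

Lemma wreath_mulV : left_inverse wreath_one wreath_inv wreath_mul.
Proof.
move=> x; apply: wreathP => [w|]; last by rewrite /= mulVg.
by rewrite wbaseME wbaseVE wbase1E mulVg.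
Qed.

Lemma wreath_mul_V : right_inverse wreath_one wreath_inv wreath_mul.
Proof.
move=> x; apply: wreathP => [w|]; last by rewrite /= mulgV.
by rewrite wbaseME wbaseVE wbase1E mulgK mulgV.
Qed.

HB.instance Definition _ := isGroup.Build (wreath A U)
  wreath_mulA wreath_mul1 wreath_mul_1 wreath_mulV wreath_mul_V.

End WreathGroup.

(* ['Z_p] is the integers mod p only for 1 < p. *)
Definition Cp_mul (p : nat) : groupType := Algebra.to_multiplicative 'Z_p.
Definition Z2_mul : groupType := Algebra.to_multiplicative (int * int)%type.

Section RotateLetters.
Variable p : nat.

Definition rot_letters_fun (i : 'I_p.+1) : 'I_p.+1 :=
  if i < p then inord (i.+1 %% p) else i.

Lemma rot_letters_inj : injective rot_letters_fun.
Proof.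
have mod_lt (i : 'I_p.+1) : i < p -> i.+1 %% p < p.
  by move=> ip; rewrite ltn_mod (leq_ltn_trans _ ip).
have rot_lt (i : 'I_p.+1) : i < p ->
    (inord (i.+1 %% p) : 'I_p.+1) = i.+1 %% p :> nat.
  by move=> ip; rewrite inordK // ltnW // ltnS mod_lt.
move=> i j; rewrite /rot_letters_fun; case: ifPn => ip; case: ifPn => jp.
- move=> /(congr1 val) /=; rewrite !rot_lt // => /eqP.
  rewrite -(addn1 i) -(addn1 j) eqn_modDr !modn_small // => /eqP.
  exact: val_inj.
- by move=> eq_j; move: jp; rewrite -eq_j rot_lt // mod_lt.
- by move=> eq_i; move: ip; rewrite eq_i rot_lt // mod_lt.
- by [].
Qed.

(* The p-cycle (0 1 ... p-1), fixing the letter p. *)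
Definition rot_letters : {perm 'I_p.+1} := perm rot_letters_inj.

End RotateLetters.

Definition defining_recursion (p : nat) (a s b : tree_aut p.+1) : Prop :=
  [/\ a = decomp (fun i => if i < p then a * s ^+ i else a * b) 1,
      s = decomp (fun i => if i < p then 1 else s) (rot_letters p)
    & b = decomp (fun i => if i < p then 1 else a) 1].

(* Main.v *)
Require Import Defs.
From HB Require Import structures.
From mathcomp Require Import all_boot all_order all_fingroup all_algebra.
From mathcomp Require Import finmap zify ring.
From mathcomp Require Import boolp classical_sets.

(** Write G for the wreath product and p = n + 2.  The
    base group of G is the additive group of Laurent polynomials in X and Y
    over Z/p, the coefficients being the lamps: an element of G is a pair
    (q, (m, l)), where sigma is the constant 1, alpha = (0, (1, 0)),
    beta = (0, (0, 1)), and conjugation by alpha, resp. beta, multiplies q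
    by X, resp. Y.

    The recursion is turned around: rather than building three tree
    automorphisms and studying the group they generate, G itself is made to
    act on words, by giving for each x in G its first-level action and its
    states as explicit elements of G.
    - At the fixed letter p the state is the image of x under the
      automorphism of G induced by the Fibonacci matrix
      (m, l) |-> (m + l, m), since alpha has state alpha beta there, beta has
      state alpha and sigma has state sigma.
    - On the letters below p, x rotates by the augmentation q(1, 1).  The
      elements fixing 0 are those with q(1, 1) = 0, i.e. q = (X - 1) g +
      (Y - 1) h, and the state at 0 is forced to be
      (g(X, 1), (m, 0)) = (q(X, 1) / (X - 1), (m, 0)): beta has a trivial
      state there, alpha has state alpha, and the commutator of sigma and
      alpha has state sigma.  The states at the other letters follow by
      multiplying by powers of sigma, whose states below p are trivial.
    Cocycle identities (first_levelM, section_atM) make this an action by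
    tree automorphisms, whose image is state-closed by construction, is
    generated by the images of alpha, sigma and beta, and satisfies the
    recursion (action_image_recursion).  A recursion of this kind determines
    the automorphisms level by level (defining_recursion_unique).

    What remains is faithfulness (tree_action_inj).  Let x = (q, (m, l)) act
    trivially.  Then q(1, 1) = 0 and the state at 0 again acts trivially, so
    q(X, 1) can be divided by X - 1 again and again; each division shortens
    the range of exponents, whence q(X, 1) = 0 (trivial_action_mass_eq).
    Applied to the iterated states at p, this says that the coefficients of q
    sum to 0 along every line l_j(w) = k, where l_j is the first coordinate
    of the j-th power of the Fibonacci matrix.  A nonzero vector is killed by
    l_j for at most one j, so for large j the form l_j separates the support
    of q, and q = 0 (trivial_action_lamp).  With q = 0, the state at the
    letter 1 has a lamp lit unless m = 0 (trivial_action_top1); applying this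
    to the state at p as well, whose first coordinate is m + l, gives
    l = 0. *)

Set Implicit Arguments.
Unset Strict Implicit.
Unset Printing Implicit Defensive.

Import Order.TTheory GRing.Theory Num.Theory.
Local Open Scope ring_scope.

(** * Lamp configurations and their partial sums *)

Section Lamplighter.
Variable n : nat.
Local Notation p := n.+2.
Local Notation lamplighter := (wreath (Cp_mul p) Z2_mul).
Implicit Types (x y : lamplighter) (P Q : pred (int * int)) (c d : 'Z_p).

Definition lamp x (w : int * int) : 'Z_p := wbase x w.
Definition top x : int * int := wtop x.

Lemma lamplighterP x y : lamp x =1 lamp y -> top x = top y -> x = y.
Proof. by move=> eq_xy eq_top; apply: (@wreathP (Cp_mul p) Z2_mul). Qed.

Lemma lamp_supp x w : (w \in finsupp (wbase x)) = (lamp x w != 0).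
Proof. exact: mem_finsupp. Qed.

Lemma lamp1 w : lamp 1%g w = 0.
Proof. exact: (@wbase1E (Cp_mul p) Z2_mul). Qed.

Lemma topM x y :
  top (x * y)%g = ((top x).1 + (top y).1, (top x).2 + (top y).2).
Proof. by []. Qed.

Lemma lampM x y w :
  lamp (x * y)%g w = lamp x w + lamp y (w.1 + (top x).1, w.2 + (top x).2).
Proof. exact: (@wbaseME (Cp_mul p) Z2_mul). Qed.

Lemma topV x : top x^-1%g = (- (top x).1, - (top x).2).
Proof. by []. Qed.

Lemma lampV x w :
  lamp x^-1%g w = - lamp x (w.1 - (top x).1, w.2 - (top x).2).
Proof. exact: (@wbaseVE (Cp_mul p) Z2_mul). Qed.

(** All linear forms needed on the base group are sums of the coefficients over
    some region: augmentation, half-planes and lines. *)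
Definition mass x P : 'Z_p := \sum_(w <- finsupp (wbase x) | P w) lamp x w.

Lemma eq_mass x P Q : P =1 Q -> mass x P = mass x Q.
Proof. by move=> PQ; apply: eq_bigl. Qed.

(** Allows the sum to be taken over any list containing the support, so that
    two elements and their product can be summed over a common list. *)
Lemma massE x P (s : seq (int * int)) :
    uniq s -> (forall w, lamp x w != 0 -> w \in s) ->
  mass x P = \sum_(w <- s | P w) lamp x w.
Proof.
move=> s_uniq supp_s; rewrite [RHS](bigID [in finsupp (wbase x)]) /=.
rewrite [X in _ + X]big1 => [|w /andP[_]]; last first.
  by rewrite lamp_supp negbK => /eqP.
rewrite addr0; under [RHS]eq_bigl do rewrite andbC.
rewrite -[RHS]big_filter_cond.
apply: perm_big; apply: uniq_perm => [||w].
- exact: fset_uniq.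
- exact: filter_uniq.
by rewrite mem_filter; case: (boolP (w \in finsupp _)) => //=; rewrite lamp_supp => /supp_s.
Qed.

Lemma massM x y P :
  mass (x * y)%g P =
  mass x P + mass y (fun w => P (w.1 - (top x).1, w.2 - (top x).2)).
Proof.
pose s := undup ((finsupp (wbase x) : seq (int * int)) ++
  [seq (w.1 - (top x).1, w.2 - (top x).2) | w <- (finsupp (wbase y) : seq (int * int))]).
have x_s w : lamp x w != 0 -> w \in s.
  by rewrite -lamp_supp mem_undup mem_cat => ->.
have y_s w : lamp y (w.1 + (top x).1, w.2 + (top x).2) != 0 -> w \in s.
  rewrite -lamp_supp mem_undup mem_cat => yw; apply/orP; right.
  by apply/mapP; eexists; first exact: yw; case: w {yw} => k l /=; rewrite !addrK.
rewrite (@massE _ _ s) ?undup_uniq // => [|w]; last first.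
  rewrite lampM; have [xw0|/x_s //] := eqVneq (lamp x w) 0.
  by rewrite xw0 add0r => /y_s.
under eq_bigr do rewrite lampM.
rewrite big_split /= -massE ?undup_uniq //; congr (_ + _).
pose tr (w : int * int) := (w.1 + (top x).1, w.2 + (top x).2).
rewrite (@massE y _ (map tr s)) ?big_map.
- by apply: eq_big => // -[k l] /=; rewrite !addrK.
- rewrite map_inj_uniq ?undup_uniq // => -[k l] [k' l'] [].
  by move=> /addIr-> /addIr->.
move=> w yw; apply/mapP; exists (w.1 - (top x).1, w.2 - (top x).2).
  by apply: y_s; rewrite /= !subrK; case: w yw.
by case: w {yw} => k l; rewrite /tr /= !subrK.
Qed.

Lemma mass_eq x w : mass x (pred1 w) = lamp x w.
Proof.
rewrite (@massE _ _ (undup (w :: (finsupp (wbase x) : seq (int * int)))))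
  ?undup_uniq //.
  rewrite -big_filter (@perm_big _ _ _ _ _ [:: w]) ?big_seq1 //.
  apply: uniq_perm; rewrite ?filter_uniq ?undup_uniq // => v.
  by rewrite mem_filter mem_undup in_cons inE /=; case: eqVneq.
by move=> v; rewrite -lamp_supp mem_undup in_cons => ->; rewrite orbT.
Qed.

Lemma mass_supp x P Q :
  (forall w, lamp x w != 0 -> P w = Q w) -> mass x P = mass x Q.
Proof.
move=> PQ; rewrite /mass big_seq_cond [RHS]big_seq_cond.
by apply: eq_bigl => w; rewrite lamp_supp; case: eqVneq => //= /PQ.
Qed.

Lemma mass_pred0 x P : (forall w, lamp x w != 0 -> P w = false) -> mass x P = 0.
Proof. by move=> /mass_supp->; rewrite /mass big_pred0. Qed.

Lemma massB x P Q : (forall w, Q w -> P w) ->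
  mass x P - mass x Q = mass x (fun w => P w && ~~ Q w).
Proof.
move=> QP; rewrite {1}/mass (bigID Q) /= addrAC.
rewrite (eq_bigl Q) ?subrr ?add0r // => w.
by case: (boolP (Q w)) => [/QP->|]; rewrite ?andbF.
Qed.

(** * The first-level action and the states *)

Definition move (m l : int) : lamplighter :=
  @Wreath (Cp_mul p) Z2_mul [fsfun] (m, l).

Definition light (c : 'Z_p) : lamplighter :=
  @Wreath (Cp_mul p) Z2_mul [fsfun w in [fset (1%g : Z2_mul)]%fset => (c : Cp_mul p) | 1%g] 1%g.

Lemma lamp_move m l w : lamp (move m l) w = 0.
Proof. by rewrite /lamp fsfunE. Qed.

Lemma lamp_light c w : lamp (light c) w = if w == (0, 0) then c else 0.
Proof. by rewrite /lamp fsfunE inE. Qed.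

Lemma mass_move m l P : mass (move m l) P = 0.
Proof. by apply: mass_pred0 => w; rewrite lamp_move eqxx. Qed.

Lemma mass_light c P : mass (light c) P = if P (0, 0) then c else 0.
Proof.
rewrite (@massE _ _ [:: (0,0)]) // => [|w].
  by rewrite big_cons big_nil lamp_light eqxx addr0.
by rewrite lamp_light mem_seq1; case: ifP => // _ /eqP.
Qed.

(** The shift by (top x).1 counts as well: state coefficients below also change
    at the exponent - (top x).1. *)
Definition bound x : nat :=
  (`|(top x).1|%N + \sum_(w <- finsupp (wbase x)) `|(w : int * int).1|%N)%N.

Lemma lamp_bound x w : lamp x w != 0 -> (`|w.1|%N <= bound x)%N.
Proof.
rewrite -lamp_supp => xw; apply: leq_trans (leq_addl _ _).
by rewrite (big_rem w) //= leq_addr.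
Qed.

(** With x = (q, (m, l)), these are the coefficients of
      (q + c - (c + q(1, 1)) X^(-m) Y^(-l))(X, 1) / (X - 1).
    The numerator is the base part of sigma^c x sigma^-(c + q(1, 1)), which
    fixes the letter 0, and the coefficient of X^k in r / (X - 1) is the sum of
    the coefficients of r above k. *)
Definition quotient_coef x (c : 'Z_p) (w : int * int) : 'Z_p :=
  if w.2 == 0 then mass x (fun v => w.1 < v.1)
    + (if w.1 < 0 then c else 0)
    - (if w.1 < - (top x).1 then c + mass x xpredT else 0)
  else 0.

Definition rotating_state x (c : 'Z_p) : lamplighter :=
  @Wreath (Cp_mul p) Z2_mul
    [fsfun w in seq_fset tt [seq (j%:Z - (bound x)%:Z, 0 : int) |
                              j <- iota 0 (bound x).*2]
      => (quotient_coef x c w : Cp_mul p) | 1%g]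
    ((top x).1, 0).

Lemma top_rotating_state x c : top (rotating_state x c) = ((top x).1, 0).
Proof. by []. Qed.

Lemma lamp_rotating_state x c w : lamp (rotating_state x c) w = quotient_coef x c w.
Proof.
rewrite /lamp fsfunE; case: ifPn => //; rewrite seq_fsetE => w_out.
rewrite /quotient_coef; case: eqP => // w2.
have {w_out w2} w1_out : (w.1 < - (bound x)%:Z) || ((bound x)%:Z <= w.1).
  apply: contraNT w_out => w1_in; apply/mapP; exists `|(w.1 + (bound x)%:Z)%R|%N.
    by rewrite mem_iota; lia.
  by case: w w2 w1_in => k l /= -> w1_in; congr (_, _); lia.
have topx : (`|(top x).1|%N <= bound x)%N by apply: leq_addr.
case/orP: w1_out => w1.
  rewrite (@mass_supp _ _ xpredT) => [|v /lamp_bound v1]; last by lia.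
  have -> : w.1 < 0 by lia.
  have -> : w.1 < - (top x).1 by lia.
  (* Below the support, the numerator being divisible by X - 1 gives 0. *)
  by rewrite [c + _]addrC subrr.
rewrite mass_pred0 => [|v /lamp_bound v1]; last by lia.
have /negbTE-> : ~~ (w.1 < 0) by lia.
have /negbTE-> : ~~ (w.1 < - (top x).1) by lia.
by rewrite addr0 subr0.
Qed.

(** The action on exponents of alpha |-> alpha beta, beta |-> alpha. *)
Definition fib (w : int * int) : int * int := (w.1 + w.2, w.1).
Definition fib_inv (w : int * int) : int * int := (w.2, w.1 - w.2).

Lemma fibK : cancel fib fib_inv.
Proof. by case=> k l; rewrite /fib /fib_inv /= addrAC subrr add0r. Qed.

Lemma fib_invK : cancel fib_inv fib.
Proof. by case=> k l; rewrite /fib /fib_inv /= addrC subrK. Qed.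

Definition fixed_state x : lamplighter :=
  @Wreath (Cp_mul p) Z2_mul
    [fsfun w in seq_fset tt [seq fib v | v <- (finsupp (wbase x) : seq (int * int))]
      => (lamp x (fib_inv w) : Cp_mul p) | 1%g]
    (fib (top x)).

Lemma top_fixed_state x : top (fixed_state x) = fib (top x).
Proof. by []. Qed.

Lemma lamp_fixed_state x w : lamp (fixed_state x) w = lamp x (fib_inv w).
Proof.
rewrite /lamp fsfunE; case: ifPn => //; rewrite seq_fsetE => w_out.
apply/esym/eqP; apply: contraNT w_out => xw; apply/mapP.
by exists (fib_inv w); rewrite ?fib_invK ?lamp_supp.
Qed.

Lemma mass_fixed_state x P : mass (fixed_state x) P = mass x (P \o fib).
Proof.
rewrite (@massE _ _ [seq fib v | v <- (finsupp (wbase x) : seq (int * int))]).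
- by rewrite big_map; apply: eq_bigr => w _; rewrite lamp_fixed_state fibK.
- by rewrite map_inj_uniq ?fset_uniq //; apply: can_inj fibK.
by move=> w; rewrite lamp_fixed_state -lamp_supp -{2}(fib_invK w); apply: map_f.
Qed.

Lemma fixed_stateM x y :
  fixed_state (x * y)%g = (fixed_state x * fixed_state y)%g.
Proof.
apply: lamplighterP => [w|]; last first.
  by rewrite !(topM, top_fixed_state) /fib /= addrACA.
rewrite !(lampM, lamp_fixed_state) top_fixed_state /fib_inv /fib /=.
congr (_ + lamp y (_, _)).
by lia.
Qed.

(** The cocycle identity at the letters below p: the first factor moves the
    letter c to c + mass x xpredT, and the corresponding correction terms of
    the two factors cancel. *)
Lemma rotating_stateM x y c :
  rotating_state (x * y)%g c =
  (rotating_state x c * rotating_state y (c + mass x xpredT))%g.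
Proof.
apply: lamplighterP => [w|]; last by rewrite topM !top_rotating_state topM addr0.
rewrite lampM !lamp_rotating_state /quotient_coef top_rotating_state !topM /= addr0.
case: eqP => // _; last by rewrite addr0.
rewrite !massM /=.
rewrite (@eq_mass y (fun v => w.1 < v.1 - (top x).1)
           (fun v => w.1 + (top x).1 < v.1)); last by move=> v; lia.
have -> : (w.1 + (top x).1 < 0) = (w.1 < - (top x).1) by lia.
have -> : (w.1 + (top x).1 < - (top y).1) = (w.1 < - ((top x).1 + (top y).1)) by lia.
by do 3!case: ifP => _; ring.
Qed.

(** * The action on the tree *)

Definition letter (c : 'Z_p) : 'I_p.+1 := widen_ord (leqnSn p) c.

Lemma letter_lt c : (letter c < p)%N.
Proof. exact: (ltn_ord c). Qed.

Lemma letterK c : (letter c)%:R = c :> 'Z_p.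
Proof. exact: natr_Zp. Qed.

Lemma letter_natr (i : 'I_p.+1) : (i < p)%N -> letter i%:R = i.
Proof.
move=> ip; apply: val_inj; rewrite -[RHS](modn_small ip).
exact: (@val_Zp_nat p).
Qed.

Lemma ltn_ord_max : ((@ord_max p) < p)%N = false.
Proof. by rewrite ltnn. Qed.

Lemma letterP (i : 'I_p.+1) : {c | i = letter c} + {i = ord_max}.
Proof.
case: (ltnP i p) => ip; first by left; exists i%:R; rewrite letter_natr.
by right; apply: val_inj; apply/eqP; rewrite eqn_leq ip -ltnS ltn_ord.
Qed.

Definition first_level x (i : 'I_p.+1) : 'I_p.+1 :=
  if (i < p)%N then letter (i%:R + mass x xpredT) else i.

Definition section_at x (i : 'I_p.+1) : lamplighter :=
  if (i < p)%N then rotating_state x i%:R else fixed_state x.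

Lemma first_level_letter x c : first_level x (letter c) = letter (c + mass x xpredT).
Proof. by rewrite /first_level letter_lt letterK. Qed.

Lemma first_level_max x : first_level x ord_max = ord_max.
Proof. by rewrite /first_level ltn_ord_max. Qed.

Lemma section_at_letter x c : section_at x (letter c) = rotating_state x c.
Proof. by rewrite /section_at letter_lt letterK. Qed.

Lemma section_at_max x : section_at x ord_max = fixed_state x.
Proof. by rewrite /section_at ltn_ord_max. Qed.

Lemma first_levelM x y i :
  first_level (x * y)%g i = first_level y (first_level x i).
Proof.
case: (letterP i) => [[c ->]|->]; last by rewrite !first_level_max.
by rewrite !first_level_letter massM addrA.
Qed.

Lemma section_atM x y i :
  section_at (x * y)%g i = (section_at x i * section_at y (first_level x i))%g.
Proof.
case: (letterP i) => [[c ->]|->].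
  by rewrite first_level_letter !section_at_letter rotating_stateM.
by rewrite first_level_max !section_at_max fixed_stateM.
Qed.

Lemma mass1 P : mass 1%g P = 0.
Proof. by apply: mass_pred0 => w; rewrite lamp1 eqxx. Qed.

Lemma first_level1 i : first_level 1%g i = i.
Proof.
case: (letterP i) => [[c ->]|->]; last by rewrite first_level_max.
by rewrite first_level_letter mass1 addr0.
Qed.

Lemma section_at1 i : section_at 1%g i = 1%g.
Proof.
apply: (mulgI (section_at 1%g i)).
by rewrite -{2}(first_level1 i) -section_atM !mulg1.
Qed.

Fixpoint act x (u : seq 'I_p.+1) : seq 'I_p.+1 :=
  if u is i :: v then first_level x i :: act (section_at x i) v else [::].

Lemma actM x y u : act (x * y)%g u = act y (act x u).
Proof.
by elim: u x y => //= i u IHu x y; rewrite first_levelM section_atM IHu.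
Qed.

Lemma act1 u : act 1%g u = u.
Proof. by elim: u => //= i u IHu; rewrite first_level1 section_at1 IHu. Qed.

Lemma act_bij x : bijective (act x).
Proof.
by exists (act x^-1%g) => u; rewrite -actM ?mulgV ?mulVg act1.
Qed.

Lemma first_level_inj x : injective (first_level x).
Proof.
move=> i j /(congr1 (first_level x^-1%g)).
by rewrite -!first_levelM mulgV !first_level1.
Qed.

Lemma act_prefix x : {mono act x : u v / prefix u v}.
Proof.
move=> u v; elim: u v x => [|i u IHu] [|j v] x //.
rewrite /= (inj_eq (@first_level_inj x)).
by case: eqP => //= ->; rewrite IHu.
Qed.

Definition tree_action x : tree_aut p.+1 := TreeAut (act_bij x) (@act_prefix x).

Lemma tree_actionM : {morph tree_action : x y / (x * y)%g}.
Proof. by move=> x y; apply: tree_autP => u /=; rewrite actM. Qed.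

Lemma level1_tree_action x i : level1 (tree_action x) i = first_level x i.
Proof. by rewrite permE. Qed.

Lemma state_tree_action x i : state (tree_action x) i = tree_action (section_at x i).
Proof. exact: tree_autP. Qed.

(** * Faithfulness *)

Definition trivial_action x := forall u, act x u = u.

Lemma trivial_action_section x i :
  trivial_action x -> trivial_action (section_at x i).
Proof. by move=> x1 u; have [] := x1 (i :: u). Qed.

Lemma trivial_action_mass x : trivial_action x -> mass x xpredT = 0.
Proof.
move=> /(_ [:: letter 0]) /(congr1 (head ord_max)) /=.
by rewrite first_level_letter add0r => /(congr1 val) /= ?; apply: val_inj.
Qed.

(** N bounds the width of the range of X-exponents of q.  The state at 0 acts
    trivially too and its base part is q(X, 1) / (X - 1), of width smaller by
    one; so it vanishes by induction, and its coefficients are the sums in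
    question. *)
Lemma trivial_action_mass_gt x (N : nat) (a k : int) :
    trivial_action x ->
    (forall w, lamp x w != 0 -> (a <= w.1) && (w.1 < a + N%:Z)) ->
  mass x (fun w => k < w.1) = 0.
Proof.
elim: N x k => [|N IHN] x k x1 x_supp.
  by apply: mass_pred0 => w /x_supp; lia.
pose y := rotating_state x 0.
have yE l : lamp y (l, 0) = mass x (fun w => l < w.1).
  rewrite lamp_rotating_state /quotient_coef /= trivial_action_mass //.
  by rewrite addr0 !if_same addr0 subr0.
have y_line w : lamp y w != 0 -> w.2 = 0.
  by rewrite lamp_rotating_state /quotient_coef; case: (w.2 =P 0) => // _; rewrite eqxx.
have y1 : trivial_action y.
  by rewrite /y -section_at_letter; apply: trivial_action_section.
have y_gt l : mass y (fun w => l < w.1) = 0.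
  (* Above a + N nothing is summed; below a the sum is the augmentation, 0. *)
  apply: IHN => // -[m m2] yw; have m20 := y_line _ yw.
  rewrite /= in m20 *; rewrite {m2}m20 yE in yw.
  apply: contraNT yw => m_out.
  have {m_out}/orP[m_lt|m_ge] : (m < a) || (a + N%:Z <= m) by lia.
    rewrite (@mass_supp _ _ xpredT) ?trivial_action_mass // => w /x_supp; lia.
  by apply/eqP/mass_pred0 => w /x_supp; lia.
rewrite -yE -mass_eq -[RHS](subrr 0) -{1}(y_gt (k - 1)) -{1}(y_gt k).
rewrite massB => [|w]; last by lia.
apply: mass_supp => -[m m2] /y_line /= ->.
by rewrite /= xpair_eqE eqxx andbT; lia.
Qed.

(** That is, q(X, 1) = 0. *)
Lemma trivial_action_mass_eq x (k : int) :
  trivial_action x -> mass x (fun w => w.1 == k) = 0.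
Proof.
move=> x1.
have x_gt l : mass x (fun w => l < w.1) = 0.
  apply: (@trivial_action_mass_gt x (bound x).*2.+1 (- (bound x)%:Z)) => // w.
  by move/lamp_bound; lia.
rewrite -[RHS](subrr 0) -{1}(x_gt (k - 1)) -{1}(x_gt k).
rewrite massB => [|w]; last by lia.
by apply: eq_mass => w; lia.
Qed.

Lemma iter_fibB j v w : iter j fib (v - w) = iter j fib v - iter j fib w.
Proof.
elim: j => //= j ->; case: (iter j fib v) (iter j fib w) => [a b] [c d].
have fst_eq : (a - c) + (b - d) = (a + b) - (c + d) by ring.
exact: (congr1 (fun k => (k, a - c)) fst_eq).
Qed.

(** The cone of vectors with coordinates of the same sign and nonzero first
    coordinate is stable. *)
Lemma fib_same_sign (w : int * int) :
  (w.1 != 0) && (0 <= w.1 * w.2) -> ((fib w).1 != 0) && (0 <= (fib w).1 * (fib w).2).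
Proof.
case: w => k l /= /andP[k0 kl_ge0].
have fib_gt0 : 0 < (k + l) * k.
  have: 0 < k * k by rewrite -expr2 exprn_even_gt0.
  by lia.
by rewrite (ltW fib_gt0) andbT; apply: contraTneq fib_gt0 => ->; rewrite mul0r.
Qed.

(** If the first coordinate vanishes at step N, then the second one does not,
    and the next step lies in the stable cone: the first coordinate never
    vanishes again. *)
Lemma iter_fib_first_neq0 (d : int * int) : d != (0, 0) ->
  exists N, forall j, (N <= j)%N -> (iter j fib d).1 != 0.
Proof.
move=> d0.
have [fib_neq0|/existsNP[N /negP]] := EM (forall j, (iter j fib d).1 != 0).
  by exists 0%N.
rewrite negbK => /eqP fN1; exists N.+1.
have fN2 : (iter N fib d).2 != 0.
  apply: contra_neq d0 => fN2.
  have {fN1 fN2}: iter N fib d = (0, 0).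
    by case: (iter N fib d) fN1 fN2 => k l /= -> ->.
  elim: N => //= N IHN /(congr1 fib_inv); rewrite fibK; exact: IHN.
have same_sign j : ((iter (N.+1 + j) fib d).1 != 0) &&
    (0 <= (iter (N.+1 + j) fib d).1 * (iter (N.+1 + j) fib d).2).
  elim: j => [|j IHj]; first by rewrite addn0 /= fN1 add0r fN2 mulr0.
  by rewrite addnS iterS; apply: fib_same_sign.
by move=> j Nj; have := same_sign (j - N.+1)%N; rewrite subnKC // => /andP[].
Qed.

Lemma iter_fib_first_neq0_seq (s : seq (int * int)) : (0, 0) \notin s ->
  exists N, forall j (d : int * int), (N <= j)%N -> d \in s -> (iter j fib d).1 != 0.
Proof.
elim: s => [|d s IHs]; first by exists 0%N.
rewrite in_cons negb_or eq_sym => /andP[/iter_fib_first_neq0[M dM] /IHs[N sN]].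
exists (maxn M N) => j e; rewrite geq_max => /andP[Mj Nj].
by rewrite in_cons => /predU1P[->|]; [apply: dM|apply: sN].
Qed.

Lemma mass_iter_fixed_state j x P :
  mass (iter j fixed_state x) P = mass x (P \o iter j fib).
Proof.
elim: j P => //= j IHj P; rewrite mass_fixed_state IHj.
exact: eq_mass.
Qed.

(** For N large, the N-th linear form takes at w a value it takes nowhere else
    on the support, so the sum over its level set is the single lamp w. *)
Lemma trivial_action_lamp x w : trivial_action x -> lamp x w = 0.
Proof.
move=> x1.
pose s := [seq v - w | v <- (finsupp (wbase x) : seq (int * int)) & v != w].
have [|N sep] := @iter_fib_first_neq0_seq s.
  apply/mapP => -[v]; rewrite mem_filter => /andP[/negP vw _] /esym/eqP.
  by rewrite subr_eq0 => /vw.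
rewrite -mass_eq.
rewrite (@mass_supp _ _ (fun v => (iter N fib v).1 == (iter N fib w).1)).
  rewrite -(mass_iter_fixed_state N x (fun v => v.1 == (iter N fib w).1)).
  apply: trivial_action_mass_eq; elim: N {sep} => //= N IHN.
  by rewrite -section_at_max; apply: trivial_action_section.
move=> v xv /=; case: eqVneq => [->|vw]; first by rewrite eqxx.
apply/esym/negbTE; rewrite -subr_eq0.
have -> : (iter N fib v).1 - (iter N fib w).1 = (iter N fib (v - w)).1.
  by rewrite iter_fibB.
by apply: sep => //; apply/mapP; exists v; rewrite // mem_filter vw lamp_supp.
Qed.

(** The base part of the state at the letter 1 is then (1 - X^(-m)) / (X - 1),
    which is 0 only if m = 0. *)
Lemma trivial_action_top1 x : trivial_action x -> (top x).1 = 0.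
Proof.
move=> x1; have /trivial_action_lamp z0 : trivial_action (rotating_state x 1).
  by rewrite -section_at_letter; apply: trivial_action_section.
have {z0} z0 k : (if k < 0 then 1 else 0) = (if k < - (top x).1 then 1 else 0) :> 'Z_p.
  have := z0 (k, 0); rewrite lamp_rotating_state /quotient_coef /=.
  rewrite trivial_action_mass // addr0 mass_pred0 ?add0r => [/eqP|w].
    by rewrite subr_eq0 => /eqP.
  by rewrite trivial_action_lamp ?eqxx.
have [m_lt|m_gt|//] := ltrgtP (top x).1 0.
  have := z0 0; rewrite ltxx ifT; last by lia.
  by move/eqP; rewrite eq_sym oner_eq0.
have := z0 (- (top x).1); rewrite ltxx ifT; last by lia.
by move/eqP; rewrite oner_eq0.
Qed.

Lemma trivial_action_eq1 x : trivial_action x -> x = 1%g.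
Proof.
move=> x1; apply: lamplighterP => [w|].
  by rewrite trivial_action_lamp // lamp1.
have top1 := trivial_action_top1 x1.
have: (top (fixed_state x)).1 = 0.
  apply: trivial_action_top1; rewrite -section_at_max.
  exact: trivial_action_section.
rewrite top_fixed_state /fib /= top1 add0r => top2.
by case: (top x) top1 top2 => m l /= -> ->.
Qed.

Lemma tree_action_inj : injective tree_action.
Proof.
move=> x y eq_xy.
have act_xy u : act x u = act y u.
  exact: (congr1 (fun f : tree_aut _ => f u) eq_xy).
have xy1 : (x * y^-1)%g = 1%g.
  by apply: trivial_action_eq1 => u; rewrite actM act_xy -actM mulgV act1.
by rewrite -(mulgVK y x) xy1 mul1g.
Qed.

(** * The image and its generators *)

Definition alpha : lamplighter := move 1 0.
Definition sigma : lamplighter := light 1.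
Definition beta : lamplighter := move 0 1.

Lemma lightX k : (sigma ^+ k)%g = light k%:R.
Proof.
elim: k => [|k IHk].
  by apply: lamplighterP => // w; rewrite lamp1 lamp_light if_same.
rewrite expgSr IHk; apply: lamplighterP => // w.
rewrite lampM !lamp_light /= !addr0 -surjective_pairing.
by case: ifP; rewrite ?addr0 // natr1.
Qed.

Lemma moveM m l m' l' : (move m l * move m' l')%g = move (m + m') (l + l').
Proof. by apply: lamplighterP => // w; rewrite lampM !lamp_move addr0. Qed.

Lemma moveV m l : (move m l)^-1%g = move (- m) (- l).
Proof. by apply: lamplighterP => // w; rewrite lampV !lamp_move oppr0. Qed.

Local Open Scope classical_set_scope.

Lemma subgroup_int_multiples (H : set lamplighter) (m l : int) :
  is_subgroup H -> H (move m l) -> forall k : int, H (move (m * k) (l * k)).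
Proof.
move=> [H1 HM HV] Hml; have Hnat (k : nat) : H (move (m * k%:Z) (l * k%:Z)).
  elim: k => [|k IHk].
    by rewrite !mulr0; congr (H _): H1; apply: lamplighterP.
  by rewrite -addn1 PoszD !mulrDr !mulr1 -moveM; apply: HM.
case=> k; first exact: Hnat.
by rewrite NegzE !mulrN -moveV; apply: HV.
Qed.

(** Conjugating powers of sigma by translations lights any lamp in any colour;
    a list containing the support is then emptied one lamp at a time. *)
Lemma generators_generate (H : set lamplighter) :
  is_subgroup H -> H alpha -> H sigma -> H beta -> forall x, H x.
Proof.
move=> HG Ha Hs Hb; have [H1 HM HV] := HG.
have Hmove m l : H (move m l).
  have := HM _ _ (subgroup_int_multiples HG Ha m) (subgroup_int_multiples HG Hb l).
  by rewrite moveM !mul1r !mul0r addr0 add0r.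
have Hlight c : H (light c).
  rewrite -[c]natr_Zp -lightX; elim: (val c) => [|k IHk]; first by [].
  by rewrite expgSr; apply: HM.
pose spot (w : int * int) c :=
  ((move w.1 w.2)^-1 * light c * move w.1 w.2)%g.
have Hspot w c : H (spot w c).
  by apply: (HM _ _ (HM _ _ (HV _ _) _)).
have lamp_spot w c v : lamp (spot w c) v = if v == w then c else 0.
  rewrite !lampM lampV !lamp_move lamp_light topV /= oppr0 add0r addr0.
  by case: v w => [k l] [k' l']; rewrite !xpair_eqE !subr_eq0.
have top_spot w c : top (spot w c) = (0, 0).
  by rewrite !topM topV /= !addr0 !addNr.
suff Hsupp (s : seq (int * int)) x : (forall w, lamp x w != 0 -> w \in s) -> H x.
  move=> x; apply: (Hsupp (finsupp (wbase x) : seq (int * int))) => w.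
  by rewrite -lamp_supp.
elim: s x => [|w s IHs] x x_supp.
  have -> : x = move (top x).1 (top x).2; last exact: Hmove.
  apply: lamplighterP => [v|]; last exact: surjective_pairing.
  by rewrite lamp_move; apply/eqP/negPn/negP => /x_supp.
have top_spotV c : top (spot w c)^-1%g = (0, 0) by rewrite topV top_spot /= oppr0.
set z := spot w (lamp x w).
rewrite -(mulVKg z x); apply: HM; first exact: Hspot.
apply: IHs => v; rewrite lampM lampV top_spotV top_spot /= !subr0.
rewrite -surjective_pairing lamp_spot.
case: (eqVneq v w) => [->|vw]; first by rewrite addNr eqxx.
by rewrite oppr0 add0r => /x_supp; rewrite in_cons (negbTE vw).
Qed.

(** This is the group generated by alpha, sigma and beta
    (action_image_generated); as the range of the action, it is visibly
    state-closed. *)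
Definition action_image : set (tree_aut p.+1) := range tree_action.

Lemma tree_action1 : tree_action 1%g = 1%g.
Proof. by apply: tree_autP => u; rewrite /= act1. Qed.

Lemma tree_actionV x : tree_action x^-1%g = (tree_action x)^-1%g.
Proof.
apply: (mulIg (tree_action x)).
by rewrite -tree_actionM !mulVg tree_action1.
Qed.

Lemma tree_actionX x k : tree_action (x ^+ k)%g = (tree_action x ^+ k)%g.
Proof.
by elim: k => [|k IHk]; rewrite ?tree_action1 // !expgSr tree_actionM IHk.
Qed.

Lemma action_image_subgroup : is_subgroup action_image.
Proof.
split; first by exists 1%g; rewrite ?tree_action1.
  by move=> _ _ [x _ <-] [y _ <-]; exists (x * y)%g; rewrite ?tree_actionM.
by move=> _ [x _ <-]; exists x^-1%g; rewrite ?tree_actionV.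
Qed.

Lemma action_image_state_closed : state_closed action_image.
Proof.
by move=> _ i [x _ <-]; exists (section_at x i); rewrite ?state_tree_action.
Qed.

Lemma action_image_generated :
  generated_subgroup [set tree_action alpha; tree_action sigma; tree_action beta] = action_image.
Proof.
rewrite eqEsubset; split.
  apply: smallest_sub; first exact: action_image_subgroup.
  by move=> _ [[->|->]|->]; [exists alpha|exists sigma|exists beta].
move=> _ [x _ <-] K [[K1 KM KV] genK].
pose H := [set y | K (tree_action y)].
apply: (@generators_generate H).
- split; rewrite /H /=; first by rewrite tree_action1.
    by move=> y z Ky Kz; rewrite tree_actionM; apply: KM.
  by move=> y Ky; rewrite tree_actionV; apply: KV.
- by apply: genK; left; left.
- by apply: genK; left; right.
by apply: genK; right.
Qed.

HB.instance Definition _ :=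
  isMultiplicative.Build lamplighter (tree_aut p.+1) tree_action tree_actionM.

Lemma isomorphic_to_action_image : isomorphic_to lamplighter action_image.
Proof. by exists tree_action; split=> //; apply: tree_action_inj. Qed.

Lemma action_image_orbit_max : level1_orbit action_image ord_max = [set ord_max]%SET.
Proof.
apply/setP => i; rewrite !inE; apply/asboolP/eqP => [[_ [x _ <-] <-]|->].
  by rewrite level1_tree_action first_level_max.
exists 1%g; first by case: action_image_subgroup.
by rewrite -tree_action1 level1_tree_action first_level_max.
Qed.

Lemma action_image_orbit_letter c : level1_orbit action_image (letter c) = [set~ ord_max]%SET.
Proof.
apply/setP => i; rewrite !inE; apply/asboolP/idP => [[_ [x _ <-] <-]|i_neq].
  rewrite level1_tree_action first_level_letter.
  apply/eqP => /(congr1 val) /= eq_p.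
  by have := letter_lt (c + mass x xpredT); rewrite /= eq_p ltnn.
case: (letterP i) i_neq => [[d ->] _|->]; last by rewrite eqxx.
exists (tree_action (light (d - c))); first by exists (light (d - c)).
by rewrite level1_tree_action first_level_letter mass_light addrC subrK.
Qed.

Lemma action_image_orbit_type : has_orbit_type action_image [:: p; 1%N].
Proof.
have orbits : level1_orbits action_image = [set [set~ ord_max]; [set ord_max]]%SET.
  apply/setP => B; rewrite !inE; apply/imsetP/orP => [[i _ ->]|[/eqP->|/eqP->]].
  - case: (letterP i) => [[c ->]|->]; first by left; rewrite action_image_orbit_letter.
    by right; rewrite action_image_orbit_max.
  - by exists (letter 0); rewrite ?action_image_orbit_letter.
  by exists ord_max; rewrite ?action_image_orbit_max.
have neq : [set~ ord_max]%SET != [set ord_max]%SET :> {set 'I_p.+1}.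
  by apply/eqP => /setP/(_ ord_max); rewrite !inE eqxx.
rewrite /has_orbit_type.
have /(perm_map (fun B : {set 'I_p.+1} => #|B|)) /= : perm_eq
    (enum (level1_orbits action_image)) [:: [set~ ord_max]; [set ord_max]]%SET.
  apply: uniq_perm; rewrite ?enum_uniq //= ?inE ?neq // => B.
  by rewrite mem_enum orbits !inE.
by rewrite cardsC1 cards1 card_ord.
Qed.

(** * The recursion and its uniqueness *)

Lemma fixed_state_move m l : fixed_state (move m l) = move (m + l) m.
Proof. by apply: lamplighterP => // w; rewrite lamp_fixed_state !lamp_move. Qed.

Lemma fixed_state_sigma : fixed_state sigma = sigma.
Proof.
apply: lamplighterP => // -[k l]; rewrite lamp_fixed_state !lamp_light /fib_inv /=.
by congr (if _ then _ else _); rewrite !xpair_eqE; lia.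
Qed.

Lemma rotating_state_alpha c : rotating_state alpha c = (alpha * light c)%g.
Proof.
apply: lamplighterP => // -[k l].
rewrite lampM lamp_rotating_state /quotient_coef lamp_move lamp_light !mass_move.
rewrite !add0r addr0 /= addr0 xpair_eqE.
rewrite [k + 1 == 0](_ : _ = (k < 0) && ~~ (k < -1)); last by lia.
case: (l =P 0) => _; last by rewrite andbF.
rewrite andbT; case: (ltP k (-1)) => k1 /=; last by rewrite andbT subr0.
by rewrite andbF ifT ?subrr //; lia.
Qed.

Lemma rotating_state_sigma c : rotating_state sigma c = 1%g.
Proof.
apply: lamplighterP => // -[k l].
rewrite lamp_rotating_state /quotient_coef lamp1 !mass_light /= oppr0.
by case: (l =P 0) => // _; case: (k < 0); ring.
Qed.

Lemma rotating_state_beta c : rotating_state beta c = 1%g.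
Proof.
apply: lamplighterP => // -[k l].
rewrite lamp_rotating_state /quotient_coef lamp1 !mass_move /= oppr0 add0r addr0.
by rewrite subrr if_same.
Qed.

Lemma rot_letters_letter c : rot_letters p (letter c) = letter (c + 1).
Proof.
rewrite permE /rot_letters_fun letter_lt; apply: val_inj => /=.
by rewrite inordK ?addn1 // (ltn_trans (ltn_pmod _ _)).
Qed.

Lemma rot_letters_max : rot_letters p ord_max = ord_max.
Proof. by rewrite permE /rot_letters_fun ltn_ord_max. Qed.

Lemma tree_action_decomp x (c : 'I_p.+1 -> tree_aut p.+1) (t : {perm 'I_p.+1}) :
    (forall i, first_level x i = t i) ->
    (forall i, tree_action (section_at x i) = c i) ->
  tree_action x = decomp c t.
Proof.
by move=> xt xc; apply: tree_autP => -[|i u] //=; rewrite xt -xc.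
Qed.

Lemma action_image_recursion :
  defining_recursion (tree_action alpha) (tree_action sigma) (tree_action beta).
Proof.
split; apply: tree_action_decomp => i; case: (letterP i) => [[c ->]|->];
  rewrite ?letter_lt ?ltn_ord_max ?perm1 ?first_level_letter ?first_level_max
    ?section_at_letter ?section_at_max ?mass_move ?mass_light ?addr0 //.
- by rewrite rotating_state_alpha tree_actionM -tree_actionX lightX letterK.
- by rewrite fixed_state_move -tree_actionM moveM.
- by rewrite rot_letters_letter.
- by rewrite rot_letters_max.
- by rewrite rotating_state_sigma tree_action1.
- by rewrite fixed_state_sigma.
- by rewrite rotating_state_beta tree_action1.
by rewrite fixed_state_move.
Qed.

Definition agree (k : nat) (f g : tree_aut p.+1) :=
  forall u, (size u <= k)%N -> f u = g u.

Lemma agreeM k f g f' g' :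
  agree k f f' -> agree k g g' -> agree k (f * g)%g (f' * g')%g.
Proof.
by move=> ff gg u uk; rewrite !autME -ff // gg // size_aut.
Qed.

Lemma agreeX k f g m : agree k f g -> agree k (f ^+ m)%g (g ^+ m)%g.
Proof.
by move=> fg; elim: m => [|m IHm] //; rewrite !expgSr; apply: agreeM.
Qed.

Lemma agree_decomp k (c c' : 'I_p.+1 -> tree_aut p.+1) t :
  (forall i, agree k (c i) (c' i)) -> agree k.+1 (decomp c t) (decomp c' t).
Proof. by move=> cc' [|i u] //= uk; rewrite cc'. Qed.

(** The recursion expresses the action on words of length k + 1 through the
    first-level permutations, which it prescribes, and the action on words of
    length k. *)
Lemma defining_recursion_unique a s b a' s' b' :
    @defining_recursion p a s b -> @defining_recursion p a' s' b' ->
  [/\ a' = a, s' = s & b' = b].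
Proof.
move=> [aE sE bE] [a'E s'E b'E].
suff agree_all k : [/\ agree k a' a, agree k s' s & agree k b' b].
  by split; apply: tree_autP => u; have [? ? ?] := agree_all (size u); auto.
elim: k => [|k [a_k s_k b_k]].
  by split=> u; rewrite leqn0 => /nilP->;
    rewrite !(size0nil (size_aut _ [::])).
split.
- rewrite aE a'E; apply: agree_decomp => i; case: ifP => _.
    by apply: agreeM => //; apply: agreeX.
  exact: agreeM.
- by rewrite sE s'E; apply: agree_decomp => i; case: ifP.
by rewrite bE b'E; apply: agree_decomp => i; case: ifP.
Qed.

End Lamplighter.

Theorem theoremD :
  (forall p : nat, prime p ->
     self_similar_of_type (wreath (Cp_mul p) Z2_mul) p.+1 [:: p; 1%N] /\
     exists a s b : tree_aut p.+1,
       [/\ defining_recursion a s b,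
           forall a' s' b' : tree_aut p.+1, defining_recursion a' s' b' ->
             [/\ a' = a, s' = s & b' = b],
           isomorphic_to (wreath (Cp_mul p) Z2_mul)
             (generated_subgroup [set a; s; b]%classic),
           state_closed (generated_subgroup [set a; s; b]%classic)
         & has_orbit_type (generated_subgroup [set a; s; b]%classic) [:: p; 1%N]]) /\
  self_similar (wreath (Cp_mul 2) Z2_mul) 3.
Proof.
split=> [[|[|n]] // _|].
  split.
    exists (@action_image n); split.
    - exact: action_image_subgroup.
    - exact: action_image_state_closed.
    - exact: action_image_orbit_type.
    exact: isomorphic_to_action_image.
  exists (tree_action (alpha n)), (tree_action (sigma n)), (tree_action (beta n)).
  rewrite action_image_generated; split.
  - exact: action_image_recursion.
  - by move=> a s b; apply: defining_recursion_unique; apply: action_image_recursion.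
  - exact: isomorphic_to_action_image.
  - exact: action_image_state_closed.
  exact: action_image_orbit_type.
exists (@action_image 0); split.
- exact: action_image_subgroup.
- exact: action_image_state_closed.
exact: isomorphic_to_action_image.
Qed.
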